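(* For every $\epsilon>0$ there is a problem instance with identical resources (all delays equal) such that $$\min_{N\in\mathcal{N}} C(N)\;\le\;\frac{3}{5}(1+\epsilon)\,\max_{N\in\mathcal{N}} C(N),$$ where $\mathcal{N}$ is the set of all Nash assignments of the instance. (The weights and the number of tasks of the instance are allowed to depend on $\epsilon$.)
   Context: A problem instance $(T,R)$ consists of a set $R=\{1,\dots,m\}$ of resources with delays (positive reals) $d_1\le\dots\le d_m$ and a set $T=\{1,\dots,n\}$ of tasks with real weights $w_1,\dots,w_n\ge 1$. An assignment is a vector $A=(A_1,\dots,A_n)\in\{1,\dots,m\}^n$ (task $i$ is assigned to resource $A_i$). The load of resource $\ell$ in $A$ is $L(\ell,A)=d_\ell\sum_{i\in T:\,A_i=\ell}w_i$, the load of task $i$ is $L(A_i,A)$, and the social cost is $C(A)=\sum_{i\in T}L(A_i,A)$. An assignment $A$ is a Nash assignment if for every task $i$ and every resource $\ell$ we have $L(A_i,A)\le L(\ell,A')$, where $A'$ is obtained from $A$ by re-assigning task $i$ to resource $\ell$ and making no other change. $\mathcal{N}=\mathcal{N}(T,R)$ is the set of all Nash assignments; it is known to be nonempty. *)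

(* Defs.v *)
From HB Require Import structures.
From mathcomp Require Import all_boot all_order all_algebra.
From mathcomp Require Import reals.
From mathcomp Require Import ring lra.
Set Implicit Arguments.
Unset Strict Implicit.
Unset Printing Implicit Defensive.
Import Order.TTheory GRing.Theory Num.Theory.
Local Open Scope ring_scope.

(* Resources and tasks are numbered from 0.  Both sets are required to be
   nonempty: an instance without tasks has C = 0 for its only assignment,
   which would make comparisons of social costs vacuous. *)
Record instance (R : realType) := Instance {
  nres : nat;
  ntask : nat;
  nres_gt0 : (0 < nres)%N;
  ntask_gt0 : (0 < ntask)%N;
  delay : 'I_nres -> R;
  weight : 'I_ntask -> R;
  delay_gt0 : forall l, 0 < delay l;
  delay_homo : forall l k : 'I_nres, (l <= k)%N -> delay l <= delay k;
  weight_ge1 : forall i, 1 <= weight i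
}.

Definition identical_resources (R : realType) (I : instance R) : Prop :=
  forall l k : 'I_(nres I), delay l = delay k.

Section Assignments.
Variables (R : realType) (I : instance R).

Definition assignment := {ffun 'I_(ntask I) -> 'I_(nres I)}.

Implicit Types (A : assignment) (i : 'I_(ntask I)) (l : 'I_(nres I)).

Definition load (l : 'I_(nres I)) (A : assignment) : R := delay l * \sum_(i | A i == l) weight i.

Definition social_cost (A : assignment) : R := \sum_i load (A i) A.

Definition reassign A i l : assignment :=
  [ffun j => if j == i then l else A j].

Definition nash : {set assignment} :=
  [set A : assignment | [forall i, forall l, load (A i) A <= load l (reassign A i l)]].

(* Existence of a Nash assignment, by minimising an exact weighted potential:
   moving task i changes it by 2 * weight i times the change of its load. *)
Definition potential A : R :=
  \sum_l delay l * (\sum_(i | A i == l) weight i) ^+ 2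
  + \sum_i delay (A i) * weight i ^+ 2.

Lemma potential_reassign A i l : l != A i ->
  potential (reassign A i l) - potential A
  = 2 * weight i * (load l (reassign A i l) - load (A i) A).
Proof.
move=> neq; set B := reassign A i l; set a := A i.
have Bi : B i = l by rewrite ffunE eqxx.
have Bj j : j != i -> B j = A j by move=> /negPf ji; rewrite ffunE ji.
pose W (X : assignment) (k : 'I_(nres I)) := \sum_(j | X j == k) weight j : R.
pose V k : R := \sum_(j | (j != i) && (A j == k)) weight j.
have WA k : W A k = V k + (if k == a then weight i else 0).
  rewrite /W /V; case: (eqVneq k a) => [->|ka].
    by rewrite (bigD1 i) //= addrC; congr (_ + _); apply: eq_bigl => j; rewrite andbC.
  rewrite addr0; apply: eq_bigl => j; case: (eqVneq j i) => [->|] //.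
  by rewrite -/a eq_sym (negPf ka).
have WB k : W B k = V k + (if k == l then weight i else 0).
  rewrite /W /V; case: (eqVneq k l) => [->|kl].
    rewrite (bigD1 i) ?Bi //= addrC; congr (_ + _); apply: eq_bigl => j.
    by rewrite andbC; case: (eqVneq j i) => //= ji; rewrite Bj.
  rewrite addr0; apply: eq_bigl => j; case: (eqVneq j i) => [->|ji] /=.
    by rewrite Bi eq_sym (negPf kl).
  by rewrite Bj.
have al : a != l by rewrite eq_sym.
rewrite /potential /load -/(W B l) -/a -/(W A a).
rewrite -[\sum_k _ * _ ^+ 2]/(\sum_k delay k * W B k ^+ 2).
rewrite -[X in _ - (X + _)]/(\sum_k delay k * W A k ^+ 2).
rewrite (bigD1 l) //= (bigD1 a) //= [\sum_i0 delay (B i0) * _](bigD1 i) //=.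
rewrite [\sum_k delay k * W A k ^+ 2](bigD1 l) //=.
rewrite [\sum_(k | k != l) delay k * W A k ^+ 2](bigD1 a) //=.
rewrite [\sum_i0 delay (A i0) * _](bigD1 i) //= -/a Bi.
have -> : \sum_(k | (k != l) && (k != a)) delay k * W B k ^+ 2
        = \sum_(k | (k != l) && (k != a)) delay k * W A k ^+ 2.
  by apply: eq_bigr => k /andP[kl ka]; rewrite WA WB (negPf kl) (negPf ka).
have -> : \sum_(j | j != i) delay (B j) * weight j ^+ 2
        = \sum_(j | j != i) delay (A j) * weight j ^+ 2.
  by apply: eq_bigr => j ji; rewrite Bj.
rewrite !WA !WB !eqxx (negPf neq) (negPf al).
ring.
Qed.

Lemma nash_exists : exists A, A \in nash.
Proof.
pose A0 : assignment := [ffun=> Ordinal (nres_gt0 I)].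
case: (@arg_minP _ _ _ A0 xpredT potential) => // A _ Amin.
exists A; rewrite inE; apply/forallP => i; apply/forallP => l.
have [->|neq] := eqVneq l (A i).
  suff -> : reassign A i (A i) = A by [].
  by apply/ffunP => j; rewrite ffunE; case: eqP => // ->.
have w_gt0 : 0 < 2 * weight i.
  by rewrite mulr_gt0 // (lt_le_trans ltr01) // weight_ge1.
rewrite -subr_ge0 -(pmulr_rge0 _ w_gt0) -potential_reassign // subr_ge0.
exact: Amin.
Qed.

Definition some_nash : assignment := xchoose nash_exists.

Definition min_nash_cost : R :=
  social_cost [arg min_(A < some_nash in nash) social_cost A]%O.

Definition max_nash_cost : R :=
  social_cost [arg max_(A > some_nash in nash) social_cost A]%O.

Lemma min_nash_costP :
  (exists2 A, A \in nash & social_cost A = min_nash_cost) /\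
  (forall A, A \in nash -> min_nash_cost <= social_cost A).
Proof.
rewrite /min_nash_cost; case: arg_minP => [|A nA Amin].
  exact: xchooseP nash_exists.
by split; first exists A.
Qed.

Lemma max_nash_costP :
  (exists2 A, A \in nash & social_cost A = max_nash_cost) /\
  (forall A, A \in nash -> social_cost A <= max_nash_cost).
Proof.
rewrite /max_nash_cost; case: arg_maxP => [|A nA Amax].
  exact: xchooseP nash_exists.
by split; first exists A.
Qed.

End Assignments.

(* Main.v *)
Require Import Defs.
From HB Require Import structures.
From mathcomp Require Import all_boot all_order all_algebra.
From mathcomp Require Import reals.
From mathcomp Require Import zify ring lra.
Import Order.TTheory GRing.Theory Num.Theory.
Local Open Scope ring_scope.

(** Take six identical resources, six tasks of weight 6q, six tasks of weight
    3q and 6q tasks of weight 1.  One Nash assignment has loads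
    12q, 12q, 12q (two large tasks each), 9q, 9q (three medium tasks each) and
    6q (all the unit tasks); another one puts one large task, one medium task
    and q unit tasks on every resource, so that all loads are 10q.  For large q
    the unit tasks dominate both costs, and the ratio tends to 6q / 10q. *)

Lemma load_reassign (R : realType) (I : instance R) (A : assignment I)
    (i : 'I_(ntask I)) (l : 'I_(nres I)) : l != A i ->
  load l (reassign A i l) = load l A + delay l * weight i.
Proof.
move=> neq; rewrite /load -mulrDr; congr (_ * _).
rewrite (bigD1 i) /= ?ffunE ?eqxx // addrC; congr (_ + _); apply: eq_bigl => j.
rewrite ffunE; have [->|ji] := eqVneq j i; last by rewrite andbT.
by rewrite andbF eq_sym (negPf neq).
Qed.

(** A move to a different resource only adds the moved task there, and a move to [A i] changes
    nothing, so the loads of [A] itself suffice to check the Nash condition. *)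
Lemma nash_of_load (R : realType) (I : instance R) (A : assignment I) :
  (forall i l, load (A i) A <= load l A + delay l * weight i) ->
  A \in nash I.
Proof.
move=> H; rewrite inE; apply/forallP => i; apply/forallP => l.
have [->|neq] := eqVneq l (A i); last by rewrite load_reassign.
suff -> : reassign A i (A i) = A by [].
by apply/ffunP => j; rewrite ffunE; case: eqP => // ->.
Qed.

Definition gap_weight (R : realType) (q i : nat) : R :=
  if (i < 6)%N then (6 * q)%:R else if (i < 12)%N then (3 * q)%:R else 1.

Lemma gap_weight_ge1 (R : realType) (q i : nat) :
  (0 < q)%N -> 1 <= gap_weight R q i.
Proof.
by move=> q0; rewrite /gap_weight; case: ifP => _; [|case: ifP => _ //];
  rewrite ler1n; lia.
Qed.

Definition gap_instance (R : realType) (q : nat) (q0 : (0 < q)%N) : instance R :=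
  @Instance R 6 (12 + q * 6) isT isT (fun=> 1) (fun i => gap_weight R q i)
    (fun=> ltr01) (fun _ _ _ => lexx 1) (fun i => gap_weight_ge1 R q i q0).

(** Six consecutive indices meet each residue once, and the offset 12 is a multiple of 6. Induction
    on [q] peels off one such block. *)
Lemma sum_mod6 (R : realType) (q l : nat) : (l < 6)%N ->
  \sum_(i < q * 6) (if ((12 + i) %% 6 == l)%N then 1 else 0) = q%:R :> R.
Proof.
move=> l6; elim: q => [|q IH]; first by rewrite big_ord0.
rewrite mulSnr big_split_ord /= IH -natr1; congr (_ + _).
rewrite !big_ord_recl big_ord0 /= /bump /=.
have E k : ((12 + (q * 6 + k)) %% 6 = k %% 6)%N by lia.
rewrite !E.
by case: l l6 {IH} => [|[|[|[|[|[|l]]]]]] //= _; rewrite ?add0r ?addr0.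
Qed.

Section GapAssignments.
Variables (R : realType) (q : nat) (q0 : (0 < q)%N).
Let I := gap_instance R q q0.

(** For the medium tasks 6 to 11, [i %/ 3] is 2 or 3; the successor moves them past the resources 0
    to 2 of the large tasks. *)
Definition stacked_resource (i : nat) : nat :=
  if (i < 6)%N then (i %/ 2)%N else if (i < 12)%N then (i %/ 3).+1 else 5.

Definition stacked : assignment I :=
  [ffun i : 'I_(12 + q * 6) => inord (stacked_resource i) : 'I_6].

Definition balanced : assignment I :=
  [ffun i : 'I_(12 + q * 6) => inord (i %% 6) : 'I_6].

Lemma val_stacked (i : 'I_(12 + q * 6)) :
  stacked i = stacked_resource i :> nat.
Proof.
rewrite ffunE inordK // /stacked_resource.
by case: ifP => ?; [|case: ifP => ?]; lia.
Qed.

Lemma val_balanced (i : 'I_(12 + q * 6)) : balanced i = (i %% 6)%N :> nat.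
Proof. by rewrite ffunE inordK // ltn_mod. Qed.

Definition stacked_load (l : nat) : R :=
  (if (l < 3)%N then 12 else if (l < 5)%N then 9 else 6) * q%:R.

Lemma load_stacked (l : 'I_6) : @load R I l stacked = stacked_load l.
Proof.
rewrite /load /= mul1r big_mkcond /=.
under eq_bigr => i _ do rewrite -val_eqE /= val_stacked.
(* The first 12 tasks are evaluated one by one; the unit tasks all sit on resource 5, so their sum
   has a constant term. *)
rewrite big_split_ord /=.
under [X in _ + X]eq_bigr => i _ do
  rewrite /stacked_resource /gap_weight /=.
rewrite sumr_const card_ord !big_ord_recl big_ord0.
rewrite /stacked_resource /gap_weight /stacked_load /= /bump /=.
case: l => -[|[|[|[|[|[|l]]]]]] //= _;
  rewrite ?mul0rn -?[1 *+ _]/(_%:R) ?natrM; ring.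
Qed.

Lemma load_balanced (l : 'I_6) : @load R I l balanced = 10 * q%:R.
Proof.
rewrite /load /= mul1r big_mkcond /=.
under eq_bigr => i _ do rewrite -val_eqE /= val_balanced.
rewrite big_split_ord /=.
under [X in _ + X]eq_bigr => i _ do rewrite /gap_weight /=.
rewrite sum_mod6 // !big_ord_recl big_ord0 /gap_weight /= /bump /=.
case: l => -[|[|[|[|[|[|l]]]]]] //= _; rewrite ?natrM; ring.
Qed.

(** The least load is 6q, so a move costs at least 6q plus the weight of the task. This is exactly
    12q for large and 9q for medium tasks, their current loads; unit tasks already have load 6q. *)
Lemma stacked_nash : stacked \in nash I.
Proof.
apply: nash_of_load => i l; rewrite !load_stacked val_stacked mul1r /=.
have Q0 : 0 <= q%:R :> R by [].
have lmin : 6 * q%:R <= stacked_load l.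
  by rewrite /stacked_load; do 2?case: ifP => _; lra.
suff : stacked_load (stacked_resource i) <= 6 * q%:R + gap_weight R q i by lra.
rewrite /stacked_resource /gap_weight.
case: ifP => [i6|i6]; last case: ifP => [i12|i12].
- have h : (i %/ 2 < 3)%N by lia.
  by rewrite /stacked_load h natrM; lra.
- have h : ((i %/ 3).+1 < 3)%N = false by lia.
  have h' : ((i %/ 3).+1 < 5)%N by lia.
  by rewrite /stacked_load h h' natrM; lra.
- by rewrite /stacked_load /=; lra.
Qed.

Lemma balanced_nash : balanced \in nash I.
Proof.
apply: nash_of_load => i l; rewrite !load_balanced mul1r lerDl.
exact: le_trans ler01 (weight_ge1 _).
Qed.

(** The 6q unit tasks give the quadratic term; the others give 6 * 12q + 6 * 9q. *)
Lemma cost_stacked : social_cost stacked = 36 * q%:R ^+ 2 + 126 * q%:R.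
Proof.
rewrite /social_cost.
under eq_bigr => i _ do rewrite load_stacked val_stacked.
rewrite big_split_ord /=.
under [X in _ + X]eq_bigr => i _ do
  rewrite /stacked_resource /stacked_load /=.
rewrite sumr_const card_ord !big_ord_recl big_ord0.
rewrite /stacked_resource /stacked_load /= /bump /= -[_ *+ (q * 6)]mulr_natr natrM.
ring.
Qed.

Lemma cost_balanced : social_cost balanced = 60 * q%:R ^+ 2 + 120 * q%:R.
Proof.
rewrite /social_cost.
under eq_bigr => i _ do rewrite load_balanced.
rewrite sumr_const card_ord -[_ *+ _]mulr_natr natrD natrM.
ring.
Qed.

End GapAssignments.

Theorem lemma3p4 (R : realType) (eps : R) (eps_gt0 : 0 < eps) :
  exists I : instance R,
    identical_resources I /\
    min_nash_cost I <= 3 / 5 * (1 + eps) * max_nash_cost I.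
Proof.
(* The final inequality reduces to 54 q <= eps (36 q^2 + 72 q), for which eps q >= 3/2 is enough;
   the bound 2 leaves some slack. *)
have [q qlarge] : exists q : nat, 2 / eps < q%:R.
  exists (Num.bound (2 / eps)); apply: archi_boundP.
  by rewrite divr_ge0 // ltW.
have q0 : (0 < q)%N.
  by rewrite -(ltr0n R); apply: lt_trans qlarge; rewrite divr_gt0.
have qe : 2 < eps * q%:R by rewrite mulrC -ltr_pdivrMr.
exists (gap_instance R q q0); split=> //.
have [_ minP] := min_nash_costP (gap_instance R q q0).
have [_ maxP] := max_nash_costP (gap_instance R q q0).
(* The extremal assignments need not be identified: [stacked] bounds the minimum from above and
   [balanced] the maximum from below. *)
apply: le_trans (minP _ (stacked_nash R q q0)) _.
apply: le_trans (ler_wpM2l _ (maxP _ (balanced_nash R q q0))); last first.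
  by apply: mulr_ge0; lra.
rewrite cost_stacked cost_balanced.
have Q0 : 0 < q%:R :> R by rewrite ltr0n.
nra.
Qed.
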